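(* Let $f:\mathbb{R}^n\to\mathbb{R}$ be continuously differentiable, let $x^0\in\mathbb{R}^n$, and assume that the level set $\mathcal{L}_0=\{x\in\mathbb{R}^n\mid f(x)\le f(x^0)\}$ is compact. Let $\gamma(\cdot;x,d,\xi)$ be an admissible family of search curves, let $\{x^k\}_{k\ge 0}\subset\mathbb{R}^n$ (starting at $x^0$), $\{d_k\}\subset\mathbb{R}^n$, $\{\xi_k\}\subset\mathbb{R}^p$ be sequences, put $\gamma_k(t)=\gamma(t;x^k,d_k,\xi_k)$, and suppose that $\{(x^k,\gamma_k)\}$ is generated by an iterative algorithm of the form $$x^{k+1}=\gamma_k(t_k)\qquad\text{for all }k\ge 0,$$ where: (i) for every $k$, the stepsize $t_k$ is chosen by the nonmonotone Armijo-type curve search procedure; (ii) the sequence of curves $\{\gamma_k\}$ is gradient-related to $\{x^k\}$; (iii) the sequence $\{\xi_k\}$ is bounded, i.e., there is $C>0$ with $\|\xi_k\|\le C$ for all $k$; (iv) the sequence of curves satisfies, for all $k$, the condition $\|\gamma_k(t)-\gamma_k(0)\|\le y(t\|d_k\|)$, with $y:\mathbb{R}_+\to\mathbb{R}_+$ being a forcing function (independent of $k$). Then the sequence $\{x^k\}$ admits accumulation points, and each accumulation point $\bar x$ is stationary, i.e., $\nabla f(\bar x)=0$.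
   Context: Admissible family of search curves: curves $\gamma(\cdot;x,d,\xi):[0,1]\to\mathbb{R}^n$ parametrized by $x\in\mathbb{R}^n$, $d\in\mathbb{R}^n$, $\xi\in\mathbb{R}^p$ such that: (a) $\gamma(t;x,d,\xi)$ is continuous with respect to $t,x,d$ and $\xi$; (b) $\gamma(0;x,d,\xi)=x$; (c) the velocity $\gamma'(t;x,d,\xi)=\left(\frac{\partial\gamma_1(t;x,d,\xi)}{\partial t},\ldots,\frac{\partial\gamma_n(t;x,d,\xi)}{\partial t}\right)^\top$ exists and is continuous for all $t,x,d$ and $\xi$; (d) $\gamma'(0;x,d,\xi)=d$. Gradient-related curves: $\{\gamma_k\}$ is gradient-related to $\{x^k\}$ if there exist constants $c_1,c_2>0$ such that for all $k\ge0$ $$\nabla f(x^k)^\top\gamma_k'(0)\le -c_1\|\nabla f(x^k)\|^2,\qquad \|\gamma_k'(0)\|\le c_2\|\nabla f(x^k)\|.$$ (Here $\gamma_k'(0)=d_k$.) Nonmonotone Armijo-type curve search: fix $\Delta_0\in(0,1]$, $\sigma\in(0,1)$, $\delta\in(0,1)$, $M\in\mathbb{N}$ and integers $m(k)$ with $m(0)=0$ and $0\le m(k)\le\min\{m(k-1)+1,M\}$ for $k\ge1$. At iteration $k$, start with $t=\Delta_0$; while $f(\gamma_k(t))>\max_{0\le j\le m(k)}f(x^{k-j})+\sigma t\nabla f(x^k)^\top d_k$, replace $t$ by $\delta t$; upon termination output $t_k=t$. Forcing function: a function $y:\mathbb{R}_+\to\mathbb{R}_+$ with $\lim_{t\to0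}y(t)=0$.
   Formalization: The forcing function's limit at 0 is taken over all of R_+ with 0 included, so y(0)=0 is required; if y(0)>0 is allowed the claim fails (f(x)=x^2, γ=x+td+t^2ξ, iterates alternating between 1 and 0). *)

(* Defs.v *)
(* Vectors of R^n are row vectors, of type 'rV[R]_n. *)
From HB Require Import structures.
From mathcomp Require Import all_boot all_order all_algebra.
From mathcomp Require Import boolp classical_sets functions reals.
From mathcomp Require Import topology normedtype derive.

Set Implicit Arguments.
Unset Strict Implicit.
Unset Printing Implicit Defensive.

Import Order.TTheory GRing.Theory Num.Theory.
Import numFieldNormedType.Exports.

Local Open Scope classical_set_scope.
Local Open Scope ring_scope.

Definition dotp (R : realType) (n : nat) (u v : 'rV[R]_n) : R :=
  \sum_(i < n) u ord0 i * v ord0 i.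

(* The library norm `|v| on 'rV[R]_n is the maximum norm; it induces the same
   topology as the Euclidean norm below, so compactness, continuity and
   convergence are the library's. *)
Definition enorm (R : realType) (n : nat) (v : 'rV[R]_n) : R :=
  Num.sqrt (\sum_(i < n) v ord0 i ^+ 2).

Definition gradient (R : realType) (n : nat) (f : 'rV[R]_n -> R)
    (x : 'rV[R]_n) : 'rV[R]_n :=
  \row_(i < n) 'D_(delta_mx ord0 i) f x.

Definition continuously_differentiable (R : realType) (n : nat)
    (f : 'rV[R]_n -> R) : Prop :=
  (forall x, differentiable f x) /\ continuous (gradient f).

(* Curves are total functions of t, but only their values on [0, 1] are
   meaningful: derivatives are taken within [0, 1], hence are one-sided at the
   end points. *)
Definition diff_quotient01 (R : realType) (g : R -> R) (t : R) :
    set_system R :=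
  h^-1 * (g (t + h) - g t)
    @[h --> within [set h | 0 <= t + h <= 1] (0 : R)^'].

Definition has_velocity (R : realType) (n : nat) (g : R -> 'rV[R]_n)
    (t : R) : Prop :=
  forall i : 'I_n, cvg (diff_quotient01 (fun s => g s ord0 i) t).

(* Only meaningful under has_velocity g t. *)
Definition velocity (R : realType) (n : nat) (g : R -> 'rV[R]_n)
    (t : R) : 'rV[R]_n :=
  \row_(i < n) lim (diff_quotient01 (fun s => g s ord0 i) t).

(* Joint continuity in (t, x, d, xi) on [0, 1] * R^n * R^n * R^p. *)
Definition continuous_on_params (R : realType) (n p : nat)
    (h : R -> 'rV[R]_n -> 'rV[R]_n -> 'rV[R]_p -> 'rV[R]_n) : Prop :=
  {within [set q : R * 'rV[R]_n * 'rV[R]_n * 'rV[R]_p | 0 <= q.1.1.1 <= 1],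
     continuous (fun q : R * 'rV[R]_n * 'rV[R]_n * 'rV[R]_p =>
                   h q.1.1.1 q.1.1.2 q.1.2 q.2)}.

Record admissible_family (R : realType) (n p : nat)
    (gamma : R -> 'rV[R]_n -> 'rV[R]_n -> 'rV[R]_p -> 'rV[R]_n) : Prop := {
  adm_continuous : continuous_on_params gamma;
  adm_start : forall x d xi, gamma 0 x d xi = x;
  adm_velocity : forall t x d xi, 0 <= t <= 1 ->
    has_velocity (fun s => gamma s x d xi) t;
  adm_velocity_continuous : continuous_on_params
    (fun t x d xi => velocity (fun s => gamma s x d xi) t);
  adm_velocity0 : forall x d xi, velocity (fun s => gamma s x d xi) 0 = d
}.

Definition gradient_related (R : realType) (n : nat) (f : 'rV[R]_n -> R)
    (x : nat -> 'rV[R]_n) (g : nat -> R -> 'rV[R]_n) : Prop :=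
  exists c1 c2 : R, [/\ 0 < c1, 0 < c2 & forall k : nat,
    dotp (gradient f (x k)) (velocity (g k) 0)
      <= - c1 * enorm (gradient f (x k)) ^+ 2 /\
    enorm (velocity (g k) 0) <= c2 * enorm (gradient f (x k))].

(* while_shrink reject delta t s: the loop "while reject t, replace t by
   delta * t", entered with value t, terminates with value s. *)
Inductive while_shrink (R : realType) (reject : R -> bool) (delta : R) :
    R -> R -> Prop :=
| while_exit t : ~~ reject t -> while_shrink reject delta t t
| while_step t s : reject t -> while_shrink reject delta (delta * t) s ->
    while_shrink reject delta t s.

(* The default value f (x k) of the iterated maximum is its j = 0 term; the
   conditions on m give m k <= k, so that k - j is never truncated. *)
Definition nonmonotone_ref (R : realType) (n : nat) (f : 'rV[R]_n -> R)
    (x : nat -> 'rV[R]_n) (m : nat -> nat) (k : nat) : R :=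
  \big[Num.max/f (x k)]_(j < (m k).+1) f (x (k - j)%N).

Definition memory_bound (M : nat) (m : nat -> nat) : Prop :=
  m 0%N = 0%N /\ forall k : nat, (m k.+1 <= minn (m k).+1 M)%N.

Definition armijo_curve_search (R : realType) (n : nat) (f : 'rV[R]_n -> R)
    (Delta0 sigma delta : R) (m : nat -> nat) (x d : nat -> 'rV[R]_n)
    (g : nat -> R -> 'rV[R]_n) (k : nat) (tk : R) : Prop :=
  while_shrink
    (fun t => f (g k t) > nonmonotone_ref f x m k
                          + sigma * t * dotp (gradient f (x k)) (d k))
    delta Delta0 tk.

(* y is only meaningful on R_+.  The limit at 0 is taken over all of R_+, the
   point 0 included, and thus entails y 0 = 0. *)
Definition forcing_function (R : realType) (y : R -> R) : Prop :=
  (forall t, 0 <= t -> 0 <= y t) /\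
  y t @[t --> within [set t | 0 <= t] (nbhs (0 : R))] --> (0 : R).

(* Main.v *)
(* The reference values r_k (maximum of f over the last m(k) + 1 iterates) are
   nonincreasing and converge to some rho.  A step with t_k |grad f(x^k)|^2
   small is short, by the gradient-relatedness and the forcing function, so
   f(x^k) is then close to f(x^(k+1)); since some value among any M + 1
   consecutive ones is at least rho, going backwards through such a window
   gives f(x^k) -> rho, hence t_k |grad f(x^k)|^2 -> 0 by the Armijo condition.
   On the other hand the slope of f along the curves is uniformly continuous
   in t at 0, since the parameters (x^k, d_k, xi_k) stay in a compact set; by
   the mean value theorem a rejected trial step cannot be too small as long as
   |grad f(x^k)| is bounded away from 0.  Hence grad f(x^k) -> 0. *)
Require Import Defs.
From HB Require Import structures.
From mathcomp Require Import all_boot all_order all_algebra.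
From mathcomp Require Import boolp classical_sets functions reals.
From mathcomp Require Import topology normedtype derive.
From mathcomp Require Import sequences realfun lra.

Import Order.TTheory GRing.Theory Num.Theory.
Import numFieldNormedType.Exports.

Local Open Scope classical_set_scope.
Local Open Scope ring_scope.

(** * Euclidean norm, inner product and compact cubes *)

Lemma enorm_ge0 (R : realType) (n : nat) (v : 'rV[R]_n) : 0 <= enorm v.
Proof. exact: sqrtr_ge0. Qed.

Lemma coord_le_enorm (R : realType) (n : nat) (v : 'rV[R]_n) (i : 'I_n) :
  `|v ord0 i| <= enorm v.
Proof.
rewrite -sqrtr_sqr /enorm ler_wsqrtr// (bigD1 i)//= lerDl.
by apply: sumr_ge0 => j _; exact: sqr_ge0.
Qed.

(** Bridge from Euclidean estimates on steps to the library norm, in which uniform continuity is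
    expressed. *)
Lemma norm_le_enorm (R : realType) (n : nat) (v : 'rV[R]_n) :
  `|v| <= enorm v.
Proof.
rewrite [leLHS]mx_normrE; apply/bigmax_leP; split; first exact: enorm_ge0.
by move=> [i j] _ /=; rewrite [i]ord1; exact: coord_le_enorm.
Qed.

Lemma cvg_dotp (R : realType) (n : nat) (T : Type) (F : set_system T)
    (u v : T -> 'rV[R]_n) (a b : 'rV[R]_n) :
  Filter F -> u @ F --> a -> v @ F --> b ->
  dotp (u q) (v q) @[q --> F] --> dotp a b.
Proof.
move=> FF ua vb; apply: cvg_big => [|i _]; first exact: add_continuous.
apply: cvgM.
  exact: (cvg_comp _ _ ua (@coord_continuous _ _ _ ord0 i a)).
exact: (cvg_comp _ _ vb (@coord_continuous _ _ _ ord0 i b)).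
Qed.

Lemma enorm_continuous (R : realType) (n : nat) : continuous (@enorm R n).
Proof.
move=> v; have -> : @enorm R n = Num.sqrt \o (fun w => dotp w w).
  by apply/funext => w; congr Num.sqrt; apply: eq_bigr => i _; rewrite expr2.
apply: continuous_comp; last exact: sqrt_continuous.
exact: (@cvg_dotp _ _ _ _ id id v v (nbhs_filter v)
  (@cvg_id _ _) (@cvg_id _ _)).
Qed.

(** Cubes stand in for closed Euclidean balls: a product of segments is compact, and it contains the
    ball of the same radius. *)
Lemma cube_compact (R : realType) (n : nat) (C : R) :
  compact [set v : 'rV[R]_n | forall i, v ord0 i \in `[- C, C]%R].
Proof.
apply: (@rV_compact _ _ (fun=> [set` `[- C, C]%R])) => _.
exact: segment_compact.
Qed.

Lemma enorm_cube (R : realType) (n : nat) (C : R) (v : 'rV[R]_n) :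
  enorm v <= C -> forall i, v ord0 i \in `[- C, C]%R.
Proof.
by move=> vC i; rewrite in_itv/= -ler_norml (le_trans (coord_le_enorm _ _ _ _)).
Qed.

(** * Bounds and uniform continuity on compact sets *)

Lemma compact_range_bounded (R : realType) (T : topologicalType)
    (A : set T) (g : T -> R) :
  compact A -> continuous g -> exists B : R, forall z, A z -> `|g z| <= B.
Proof.
move=> cA cg.
have /compact_bounded[B [_ hB]] : compact (g @` A).
  by apply: continuous_compact => //; exact: continuous_subspaceT.
(* Boundedness only provides bounds strictly above [B], hence the [+ 1]. *)
exists (B + 1) => z Az; apply: (hB (B + 1)); first by rewrite ltrDl.
by exists z.
Qed.

(** Near-covering compactness, applied to the increment [h = v - u] near 0, merges the local
    estimates into one radius. Only [u] has to lie in [A]. *)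
Lemma compact_unif_cont (R : realType) (V : normedModType R) (f : V -> R)
    (A : set V) :
  compact A -> continuous f -> forall e, 0 < e ->
  exists2 r, 0 < r & forall u v, A u -> `|v - u| < r -> `|f v - f u| < e.
Proof.
move=> /compact_near_coveringP cA cf e e0.
have /nbhs_ballP[r /= r0 hr] :
    \forall h \near (0 : V), A `<=` (fun u => `|f (u + h) - f u| < e).
  apply: cA => u Au; have e20 : 0 < e / 2 by rewrite divr_gt0.
  have /nbhs_ballP[r /= r0 hr] : \forall w \near u, `|f u - f w| < e / 2.
    by have /cvgrPdist_lt := cf u; exact.
  have r20 : 0 < r / 2 by rewrite divr_gt0.
  (* Halved radii keep both [w] and [w + z] in the ball of radius [r] around [u]. *)
  exists (ball u (r / 2), ball (0 : V) (r / 2)).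
    by split; exact: nbhsx_ballx.
  move=> [w z]; rewrite -!ball_normE /= sub0r normrN => -[uw z0].
  rewrite (le_lt_trans (ler_distD (f u) _ _))// [ltRHS](splitr e) ltrD//.
    rewrite distrC; apply: hr; rewrite -ball_normE /= opprD addrA.
    by rewrite (le_lt_trans (ler_normB _ _))// [ltRHS](splitr r) ltrD.
  apply: hr; rewrite -ball_normE /= (lt_le_trans uw)//.
  by rewrite ler_pdivrMr// mulr_natr mulr2n lerDl ltW.
exists r => // u v Au vu; have := hr (v - u) _ u Au.
by rewrite subrKC; apply; rewrite -ball_normE /= sub0r normrN.
Qed.

(** * The shrinking loop and the reference values *)

(** Induction on the run of the loop. The last alternative records the trial step rejected just
    before the accepted one, from which the lower bound on stepsizes comes. *)
Lemma while_shrinkP (R : realType) (reject : R -> bool) (delta a b : R) :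
  0 < delta < 1 -> 0 < a -> while_shrink reject delta a b ->
  [/\ 0 < b, b <= a, ~~ reject b &
     b = a \/ exists s, [/\ 0 < s, s <= a, b = delta * s & reject s]].
Proof.
move=> /andP[d0 d1] + H; elim: H => {a b} [a r|a b r _ IH] a0.
  by split => //; left.
have da0 : 0 < delta * a by rewrite mulr_gt0.
have daa : delta * a <= a by rewrite ler_piMl// ltW.
have [b0 ba rb H] := IH da0; split => //; first exact: le_trans daa.
right; case: H => [->|[s [s0 sa bs rs]]]; first by exists a.
by exists s; split => //; exact: le_trans daa.
Qed.

Section ref.
Context {R : realType} {n : nat}.
Variables (f : 'rV[R]_n -> R) (x : nat -> 'rV[R]_n) (m : nat -> nat).
Let r := nonmonotone_ref f x m.

Lemma ref_ge k j : (j <= m k)%N -> f (x (k - j)%N) <= r k.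
Proof.
move=> jm; rewrite /r /nonmonotone_ref.
exact: (le_bigmax _ (fun i : 'I_(m k).+1 => f (x (k - i)%N))
  (Ordinal (jm : (j < (m k).+1)%N))).
Qed.

Lemma ref_le k b : (forall j, (j <= m k)%N -> f (x (k - j)%N) <= b) -> r k <= b.
Proof.
move=> h; apply/bigmax_leP; split; first by rewrite -[k in x k]subn0; exact: h.
by move=> i _; apply: h; rewrite -ltnS.
Qed.

Lemma ref_attained k : exists2 j, (j <= m k)%N & r k <= f (x (k - j)%N).
Proof.
apply: contrapT => H.
have h j : (j <= m k)%N -> f (x (k - j)%N) < r k.
  by move=> jm; rewrite ltNge; apply/negP => ?; apply: H; exists j.
have : r k < r k; last by rewrite ltxx.
(* The default of the iterated maximum is its term [j = 0], so the strict bound covers it too. *)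
apply/bigmax_ltP; split; first by rewrite -[k in x k]subn0; exact: h.
by move=> i _; apply: h; rewrite -ltnS.
Qed.
End ref.

(** * Derivatives along curves and the mean value theorem *)

Lemma diff_gradient (R : realType) (n : nat) (f : 'rV[R]_n -> R)
    (z v : 'rV[R]_n) :
  differentiable f z -> 'd f z v = dotp (gradient f z) v.
Proof.
move=> df; rewrite {1}(row_sum_delta v) linear_sum; apply: eq_bigr => i _.
by rewrite linearZ /= mxE deriveE// mulrC.
Qed.

(** At an interior point the constraint [0 <= t + h <= 1] holds for all small [h], so restricting
    the filter changes nothing and the quotient is that of the library derivative. *)
Lemma diff_quotient01E (R : realType) (g : R -> R) (t : R) : 0 < t < 1 ->
  diff_quotient01 g t =
  ((fun h => h^-1 *: ((g \o shift t) (h *: (1 : R)) - g t)) @ (0 : R)^').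
Proof.
move=> /andP[t0 t1]; rewrite /diff_quotient01; set S := [set h | _].
have S0 : (0 : R)^' S.
  apply: nbhs_dnbhs; apply/nbhs_ballP; exists (Num.min t (1 - t)) => /=.
    by rewrite lt_min t0 subr_gt0.
  move=> h; rewrite -ball_normE /= sub0r normrN lt_min !ltr_norml /S /=.
  by move=> /andP[/andP[? ?] /andP[? ?]]; lra.
have -> : within S (0 : R)^' = (0 : R)^'.
  apply/predeqP => A; split; last exact: filterS.
  move=> SA; have {}SA : \forall h \near (0 : R)^', S h -> A h := SA.
  apply: (@filterS _ _ (dnbhs_filter _)) (filterI SA S0) => h [SAh].
  exact: SAh.
apply: (f_equal (fun F : R -> R => F @ (0 : R)^')); apply/funext => h /=.
by rewrite [h *: 1]mulr1 (addrC t).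
Qed.

Lemma is_derive_velocity (R : realType) (n : nat) (g : R -> 'rV[R]_n) (t : R) :
  0 < t < 1 -> has_velocity g t -> is_derive t 1 g (velocity g t).
Proof.
move=> t01 gt; have dg : derivable g t 1.
  apply/derivable_mxP => i j; rewrite [i]ord1.
  by rewrite /derivable -diff_quotient01E//; exact: gt.
apply: DeriveDef => //; rewrite derive_mx//; apply/rowP => i.
by rewrite !mxE /derive -diff_quotient01E.
Qed.

Lemma is_derive_along_curve (R : realType) (n : nat) (f : 'rV[R]_n -> R)
    (g : R -> 'rV[R]_n) (t : R) :
  0 < t < 1 -> has_velocity g t -> differentiable f (g t) ->
  is_derive t 1 (f \o g) (dotp (gradient f (g t)) (velocity g t)).
Proof.
move=> t01 gt df; have [dg vg] := is_derive_velocity _ _ _ _ t01 gt.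
have dg' : differentiable g t by exact/derivable1_diffP.
have dfg : differentiable (f \o g) t by exact: differentiable_comp.
apply: DeriveDef; first exact/derivable1_diffP.
rewrite deriveE// diff_comp//=; move: vg; rewrite deriveE// => ->.
exact: diff_gradient.
Qed.

(** The mean value theorem asks for derivatives only inside []0, s[], where velocities are
    two-sided; at the end points continuity suffices. *)
Lemma mean_value_along_curve (R : realType) (n : nat) (f : 'rV[R]_n -> R)
    (g : R -> 'rV[R]_n) (s : R) :
  (forall z, differentiable f z) ->
  {within [set r : R | 0 <= r <= 1], continuous g} ->
  (forall r, 0 <= r <= 1 -> has_velocity g r) ->
  0 < s <= 1 ->
  exists2 r, 0 < r < s &
    f (g s) - f (g 0) = dotp (gradient f (g r)) (velocity g r) * s.
Proof.
move=> df cg vg /andP[s0 s1].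
have [r r01||r] := @MVT R (f \o g)
  (fun r => dotp (gradient f (g r)) (velocity g r)) 0 s s0.
- move: r01; rewrite in_itv /= => /andP[r0 rs].
  have r1 := lt_le_trans rs s1.
  by apply: is_derive_along_curve => //; rewrite ?r0//; apply: vg; rewrite !ltW.
- move=> z; apply: (@continuous_comp (subspace _) _ _ g f); last first.
    by apply: differentiable_continuous; exact: df.
  move: z; apply: continuous_subspaceW cg => r.
  rewrite /= in_itv /= => /andP[-> rs].
  exact: le_trans rs s1.
- by rewrite in_itv /= subr0 => r0s ?; exists r.
Qed.

(** * Uniform continuity in [t] at 0 over compact parameter sets *)

Lemma cvg_pair_point (S : Type) (T U : topologicalType) (F : set_system S)
    (f : S -> T) (g : S -> U) (a : T) (b : U) : Filter F ->
  f @ F --> a -> g @ F --> b -> (f w, g w) @[w --> F] --> (a, b).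
Proof.
move=> FF fa gb.
exact: (@cvg_pair _ _ _ F (nbhs a) (nbhs b) _ _ _ f g fa gb).
Qed.

Lemma fst_continuous (T U : topologicalType) : continuous (@fst T U).
Proof. by move=> [a b]; exact: cvg_fst. Qed.

Lemma snd_continuous (T U : topologicalType) : continuous (@snd T U).
Proof. by move=> [a b]; exact: cvg_snd. Qed.

(** Near-covering compactness of the product of [A], [B] and [D], along the filter of [s] tending to
    0 within [[0, 1]]. *)
Lemma unif_near0 (R : realType) (n p : nat)
    (h : R -> 'rV[R]_n -> 'rV[R]_n -> 'rV[R]_p -> R)
    (A B : set 'rV[R]_n) (D : set 'rV[R]_p) :
  {within [set q : R * 'rV[R]_n * 'rV[R]_n * 'rV[R]_p | 0 <= q.1.1.1 <= 1],
     continuous (fun q : R * 'rV[R]_n * 'rV[R]_n * 'rV[R]_p =>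
                   h q.1.1.1 q.1.1.2 q.1.2 q.2)} ->
  compact A -> compact B -> compact D -> forall e, 0 < e ->
  exists2 r, 0 < r & forall s a b c, 0 <= s <= 1 -> s < r ->
    A a -> B b -> D c -> `|h s a b c - h 0 a b c| < e.
Proof.
move=> /subspace_continuousP ch cA cB cD e e0.
have /compact_near_coveringP cK := compact_setX (compact_setX cA cB) cD.
have e20 : 0 < e / 2 by rewrite divr_gt0.
pose I := [set s : R | 0 <= s <= 1].
have /nbhs_ballP[r /= r0 hr] : \forall s \near within I (nbhs (0 : R)),
    (A `*` B) `*` D `<=` (fun z : 'rV[R]_n * 'rV[R]_n * 'rV[R]_p =>
       `|h s z.1.1 z.1.2 z.2 - h 0 z.1.1 z.1.2 z.2| < e).
  apply: cK => -[[a b] c] _.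
  have q0 : [set q : R * 'rV[R]_n * 'rV[R]_n * 'rV[R]_p
      | 0 <= q.1.1.1 <= 1] (0, a, b, c) by rewrite /= lexx ler01.
  have /cvgrPdist_lt/(_ _ e20) hq := ch _ q0.
  (* Near-covering delivers the parameters first and [s] last; [phi] restores the argument order of
     [h]. *)
  pose phi (w : ('rV[R]_n * 'rV[R]_n * 'rV[R]_p) * R) :=
    (w.2, w.1.1.1, w.1.1.2, w.1.2).
  have phic : phi @ nbhs ((a, b, c), 0 : R) --> (0 : R, a, b, c).
    have h1 := @fst_continuous _ _ ((a, b, c), 0 : R).
    have h2 := cvg_comp _ _ h1 (@fst_continuous _ _ (a, b, c)).
    apply: cvg_pair_point; last first.
      exact: (cvg_comp _ _ h1 (@snd_continuous _ _ (a, b, c))).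
    apply: cvg_pair_point; last first.
      exact: (cvg_comp _ _ h2 (@snd_continuous _ _ (a, b))).
    apply: cvg_pair_point.
      exact: (@snd_continuous _ _ ((a, b, c), 0 : R)).
    exact: (cvg_comp _ _ h2 (@fst_continuous _ _ (a, b))).
  have [[U V] /= [Ua V0] UV] := phic _ hq.
  exists (U, I `&` V) => /=.
    by split => //; exact: filterS V0 => s Vs Is.
  move=> [z s] /= [Uz [Is Vs]].
  (* Both [h s] and [h 0] at [z] are compared with [h 0 a b c], each up to [e / 2]. *)
  have h1 := UV (z, s) (conj Uz Vs) Is.
  have h2 := UV (z, 0) (conj Uz (nbhs_singleton V0)) _.
  rewrite (le_lt_trans (ler_distD (h 0 a b c) _ _))// [ltRHS](splitr e) ltrD//.
    by rewrite distrC.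
  by apply: h2; rewrite /= lexx ler01.
exists r => // s a b c s01 sr Aa Bb Dc; apply: (hr s _ s01 (a, b, c)) => //.
by rewrite -ball_normE /= sub0r normrN ger0_norm//; case/andP: s01.
Qed.

Lemma slope_continuous (R : realType) (n p : nat) (f : 'rV[R]_n -> R)
    (gamma : R -> 'rV[R]_n -> 'rV[R]_n -> 'rV[R]_p -> 'rV[R]_n) :
  continuous (gradient f) -> admissible_family gamma ->
  {within [set q : R * 'rV[R]_n * 'rV[R]_n * 'rV[R]_p | 0 <= q.1.1.1 <= 1],
     continuous (fun q : R * 'rV[R]_n * 'rV[R]_n * 'rV[R]_p =>
       dotp (gradient f (gamma q.1.1.1 q.1.1.2 q.1.2 q.2))
         (velocity (fun s => gamma s q.1.1.2 q.1.2 q.2) q.1.1.1))}.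
Proof.
move=> cg [cgam _ _ cvel _] z.
apply: (@cvg_dotp _ _ _ _ _ _ _ _ (nbhs_filter _)); last exact: cvel.
exact: (cvg_comp _ _ (cgam z) (cg _)).
Qed.

Lemma admissible_curve_continuous (R : realType) (n p : nat)
    (gamma : R -> 'rV[R]_n -> 'rV[R]_n -> 'rV[R]_p -> 'rV[R]_n) a b c :
  admissible_family gamma ->
  {within [set r : R | 0 <= r <= 1], continuous (fun s => gamma s a b c)}.
Proof.
move=> [/subspace_continuousP cgam _ _ _ _].
apply/subspace_continuousP => s s01.
have phic : (r, a, b, c) @[r --> s] --> (s, a, b, c).
  by do 3!(apply: cvg_pair_point; last exact: cvg_cst).
by move=> P /(cgam (s, a, b, c) s01)/phic.
Qed.

(** * Real sequences with nonmonotone decrease *)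

(** From a good index at most [M] places ahead, [step] is applied backwards at most [M] times. Since
    this number is bounded, the tolerances can be composed in advance. *)
Lemma backward_propagation (R : realType) (a : nat -> R) (rho : R) (M : nat) :
  (forall k, exists2 i, (i <= M)%N & rho <= a (k + i)%N) ->
  (forall e, 0 < e -> exists2 eta, 0 < eta & exists N, forall k, (N <= k)%N ->
     rho - eta <= a k.+1 -> rho - e <= a k) ->
  forall e, 0 < e -> exists N, forall k, (N <= k)%N -> rho - e <= a k.
Proof.
move=> win step.
have prop j : forall e, 0 < e -> exists2 eta, 0 < eta & exists N,
    forall k i, (N <= k)%N -> (i <= j)%N ->
      rho - eta <= a (k + i)%N -> rho - e <= a k.
  elim: j => [|j IH] e e0.
    exists e => //; exists 0%N => k i _.
    by rewrite leqn0 => /eqP->; rewrite addn0.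
  have [eta1 eta10 [N1 h1]] := step _ e0.
  have [eta2 eta20 [N2 h2]] := IH _ eta10.
  (* [e] settles the case [i = 0]; [eta2] serves the induction hypothesis, started at [k.+1]. *)
  exists (Num.min eta2 e); first by rewrite lt_min eta20.
  exists (maxn N1 N2) => k [|i]; rewrite geq_max => /andP[k1 k2] ij.
    by rewrite addn0; apply: le_trans; rewrite lerD2l lerN2 ge_min lexx orbT.
  move=> h; apply: h1 => //; apply: (h2 _ i) => //; first exact: leqW.
  by rewrite addSnnS (le_trans _ h)// lerD2l lerN2 ge_min lexx.
move=> e e0; have [eta eta0 [N h]] := prop M _ e0.
exists N => k Nk; have [i iM ai] := win k; apply: (h _ i) => //.
by rewrite (le_trans _ ai)// lerBlDr lerDl ltW.
Qed.

(** To be used with [a k = f (x k)], [r] the reference values and [q k] the product of the stepsize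
    and the squared gradient norm. Once [a] and [r] are squeezed around the limit of [r], the
    decrease leaves no room for [q]. *)
Lemma nonmonotone_decrease (R : realType) (a r q : nat -> R)
    (kappa b : R) (M : nat) :
  0 < kappa -> (forall k, r k.+1 <= r k) -> (forall k, b <= r k) ->
  (forall k, exists2 i, (i <= M)%N & r (k + M)%N <= a (k + i)%N) ->
  (forall k, a k.+1 + kappa * q k <= r k) ->
  (forall e, 0 < e -> exists2 eta, 0 < eta &
     forall k, q k < eta -> `|a k.+1 - a k| < e) ->
  forall e, 0 < e -> exists N, forall k, (N <= k)%N -> q k < e.
Proof.
move=> k0 rS rb win dec cont.
have r_ni : nonincreasing_seq r by apply/nonincreasing_seqP.
have r_cvg : cvgn r.
  by apply: nonincreasing_is_cvgn => //; exists b => _ [k _ <-].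
pose rho := limn r.
have rho_le k : rho <= r k by exact: nonincreasing_cvgn_ge.
have r_near e : 0 < e -> exists N, forall k, (N <= k)%N -> r k < rho + e.
  move=> e0; have /cvgrPdist_lt/(_ _ e0)[N _ hN] := r_cvg.
  exists N => k /hN /=; rewrite ltr_norml => /andP[h _].
  by rewrite -ltrBlDl -opprB ltrNl.
have a_ge : forall e, 0 < e -> exists N, forall k, (N <= k)%N -> rho - e <= a k.
  apply: (@backward_propagation _ _ _ M) => [k|e e0].
    by have [i iM h] := win k; exists i => //; exact: le_trans h.
  have e20 : 0 < e / 2 by rewrite divr_gt0.
  have [eta eta0 h] := cont _ e20.
  (* With [r k < rho + eps] and [rho - eps <= a k.+1], the decrease gives
     [kappa * q k < 2 * eps <= kappa * eta]; the bound [e / 2] leaves room for the change from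
     [a k.+1] to [a k]. *)
  pose eps := Num.min (e / 2) (kappa * eta / 2).
  have eps0 : 0 < eps by rewrite lt_min e20 divr_gt0// mulr_gt0.
  have [N hN] := r_near _ eps0.
  exists eps => //; exists N => k Nk ak.
  have e1 : eps <= e / 2 by rewrite ge_min lexx.
  have e2 : eps <= kappa * eta / 2 by rewrite ge_min lexx orbT.
  have qk : q k < eta.
    by rewrite -(ltr_pM2l k0); have := dec k; have := hN _ Nk; lra.
  by have := h _ qk; rewrite ltr_norml => /andP[? ?]; lra.
move=> e e0; have ke : 0 < kappa * e / 2 by rewrite divr_gt0// mulr_gt0.
have [N1 h1] := r_near _ ke; have [N2 h2] := a_ge _ ke.
exists (maxn N1 N2) => k; rewrite geq_max => /andP[/h1 rk kN2].
rewrite -(ltr_pM2l k0); have := dec k; have := h2 k.+1 (leqW kN2); lra.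
Qed.

(** * Short steps and rejected trial steps *)

(** Compare squares: since [t <= 1], [(t * D) ^+ 2 <= t * D ^+ 2 <= c ^+ 2 * (t * G ^+ 2)]. *)
Lemma small_step (R : realType) (t G D c theta : R) :
  0 <= t <= 1 -> 0 <= D -> 0 < c -> 0 < theta -> D <= c * G ->
  t * G ^+ 2 < (theta / c) ^+ 2 -> t * D < theta.
Proof.
move=> /andP[t0 t1] D0 c0 th0 DG h.
rewrite -(@ltr_pXn2r _ 2)// ?nnegrE ?mulr_ge0 ?(ltW th0)//.
have D2 : D ^+ 2 <= c ^+ 2 * G ^+ 2.
  by rewrite -exprMn lerXn2r ?nnegrE// (le_trans D0).
have h2 : c ^+ 2 * (t * G ^+ 2) < theta ^+ 2.
  by rewrite mulrC -ltr_pdivlMr ?exprn_gt0// -expr_div_n.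
apply: le_lt_trans h2; rewrite exprMn [leRHS]mulrCA.
apply: (le_trans _ (ler_wpM2l t0 D2)).
by rewrite ler_wpM2r ?sqr_ge0// expr2 ler_piMl.
Qed.

(** For small [s], all slopes on [[0, s]] differ from the initial one by less than
    [(1 - sigma) * e], hence stay below [sigma] times the initial slope. Rejection and the mean
    value theorem yield a slope above that value. *)
Lemma rejected_step_bounded_below (R : realType) (n p : nat)
    (f : 'rV[R]_n -> R)
    (gamma : R -> 'rV[R]_n -> 'rV[R]_n -> 'rV[R]_p -> 'rV[R]_n)
    (A B : set 'rV[R]_n) (D : set 'rV[R]_p) (sigma : R) :
  continuously_differentiable f -> admissible_family gamma -> sigma < 1 ->
  compact A -> compact B -> compact D -> forall e, 0 < e ->
  exists2 tau, 0 < tau & forall s a b c, 0 < s <= 1 -> A a -> B b -> D c ->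
    dotp (gradient f a) b <= - e ->
    f a + sigma * s * dotp (gradient f a) b < f (gamma s a b c) -> tau <= s.
Proof.
move=> [df cg] adm s1 cA cB cD e e0.
have e'0 : 0 < (1 - sigma) * e by rewrite mulr_gt0// subr_gt0.
have [tau tau0 htau] := unif_near0 _ _ _
  (fun s a b c => dotp (gradient f (gamma s a b c))
                    (velocity (fun s => gamma s a b c) s)) _ _ _
  (slope_continuous _ _ _ _ _ cg adm) cA cB cD _ e'0.
exists tau => // s a b c /andP[s0 sle1] Aa Bb Dc slope rej.
rewrite leNgt; apply/negP => s_tau.
have [r /andP[r0 rs] mv] := @mean_value_along_curve _ _ f
  (fun s => gamma s a b c) s df
  (admissible_curve_continuous _ _ _ _ a b c adm)
  (fun r => @adm_velocity _ _ _ _ adm r a b c)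
  (introT andP (conj s0 sle1)).
move: mv; rewrite (adm_start adm) => mv.
have := htau r a b c _ (lt_trans rs s_tau) Aa Bb Dc.
rewrite (adm_start adm) (adm_velocity0 adm) ltW//=.
rewrite (ltW (lt_le_trans rs sle1)) => /(_ isT).
rewrite ltr_norml => /andP[_ hr].
have : sigma * dotp (gradient f a) b * s <
    dotp (gradient f (gamma r a b c)) (velocity (fun s => gamma s a b c) r) * s.
  by rewrite -mv; move: rej; rewrite mulrAC; lra.
rewrite ltr_pM2r// => hr2.
have sigma1 : 0 <= 1 - sigma by rewrite subr_ge0 ltW.
by have := ler_wpM2l sigma1 slope; lra.
Qed.

(** * The memory window of the reference values *)

Lemma memory_le (M : nat) (m : nat -> nat) (k : nat) :
  memory_bound M m -> (m k <= minn k M)%N.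
Proof.
move=> [m0 mS]; elim: k => [|k IH]; first by rewrite m0.
apply: leq_trans (mS k) _; rewrite leq_min geq_minr andbT geq_min ltnS.
by move: IH; rewrite leq_min => /andP[-> _].
Qed.

(** Apart from the new value [f (x k.+1)], the window at [k.+1] only looks at indices of the window
    at [k], because [m k.+1 <= (m k).+1]. *)
Lemma ref_nonincreasing (R : realType) (n : nat) (f : 'rV[R]_n -> R)
    (x : nat -> 'rV[R]_n) (M : nat) (m : nat -> nat) :
  memory_bound M m ->
  (forall k, f (x k.+1) <= nonmonotone_ref f x m k) ->
  forall k, nonmonotone_ref f x m k.+1 <= nonmonotone_ref f x m k.
Proof.
move=> [_ mS] dec k; apply: ref_le => -[|j] jm; first by rewrite subn0.
rewrite subSS; apply: ref_ge; rewrite -ltnS (leq_trans jm)//.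
by rewrite (leq_trans (mS k))// geq_minl.
Qed.

Lemma ref_window (R : realType) (n : nat) (f : 'rV[R]_n -> R)
    (x : nat -> 'rV[R]_n) (M : nat) (m : nat -> nat) (k : nat) :
  memory_bound M m ->
  exists2 i, (i <= M)%N & nonmonotone_ref f x m (k + M)%N <= f (x (k + i)%N).
Proof.
move=> mem; have [j jm h] := ref_attained f x m (k + M).
have jM : (j <= M)%N.
  by rewrite (leq_trans jm)// (leq_trans (memory_le _ _ _ mem))// geq_minr.
by exists (M - j)%N; [exact: leq_subr|rewrite addnBA].
Qed.

(** * Vanishing gradients along the iterates *)

Theorem proposition5 (R : realType) (n p : nat)
  (f : 'rV[R]_n -> R) (x0 : 'rV[R]_n)
  (gamma : R -> 'rV[R]_n -> 'rV[R]_n -> 'rV[R]_p -> 'rV[R]_n)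
  (x d : nat -> 'rV[R]_n) (xi : nat -> 'rV[R]_p) (t : nat -> R)
  (Delta0 sigma delta : R) (M : nat) (m : nat -> nat) (y : R -> R)
  (gamma_ := fun (k : nat) (s : R) => gamma s (x k) (d k) (xi k)) :
  continuously_differentiable f ->
  compact [set z : 'rV[R]_n | f z <= f x0] ->
  admissible_family gamma ->
  0 < Delta0 <= 1 -> 0 < sigma < 1 -> 0 < delta < 1 ->
  memory_bound M m ->
  x 0%N = x0 ->
  (forall k : nat, x k.+1 = gamma_ k (t k)) ->
  (forall k : nat,
     armijo_curve_search f Delta0 sigma delta m x d gamma_ k (t k)) ->
  gradient_related f x gamma_ ->
  (exists2 C : R, 0 < C & forall k : nat, enorm (xi k) <= C) ->
  forcing_function y ->
  (forall (k : nat) (s : R), 0 <= s <= 1 ->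
     enorm (gamma_ k s - gamma_ k 0) <= y (s * enorm (d k))) ->
  (exists xbar : 'rV[R]_n, cluster (x @ \oo) xbar) /\
  (forall xbar : 'rV[R]_n, cluster (x @ \oo) xbar -> gradient f xbar = 0).
Proof.
move=> fC1 L0c adm /andP[D0 D1] /andP[s0 s1] d01 mem x0E xS armijo
  [c1 [c2 [c10 c20 grel]]] [C C0 xiC] [y0 ycvg] yx.
have [df cg] := fC1.
have cf : continuous f by move=> z; apply: differentiable_continuous; exact: df.
pose g k := gradient f (x k); pose G k := enorm (g k).
pose r := nonmonotone_ref f x m.
have gammaV k : velocity (gamma_ k) 0 = d k by exact: adm_velocity0.
have gamma0 k : gamma_ k 0 = x k by exact: adm_start.
have slope k : dotp (g k) (d k) <= - c1 * G k ^+ 2.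
  by have [+ _] := grel k; rewrite gammaV.
have dG k : enorm (d k) <= c2 * G k by have [_] := grel k; rewrite gammaV.
have search k : [/\ 0 < t k, t k <= Delta0,
    f (x k.+1) <= r k + sigma * t k * dotp (g k) (d k) &
    t k = Delta0 \/ exists s, [/\ 0 < s, s <= Delta0, t k = delta * s &
      r k + sigma * s * dotp (g k) (d k) < f (gamma_ k s)]].
  have [? ? + ?] := while_shrinkP _ _ _ _ _ d01 D0 (armijo k).
  by rewrite -leNgt -xS; split.
have t01 k : 0 <= t k <= 1.
  by have [t0 tD _ _] := search k; rewrite ltW//= (le_trans tD).
pose q k := t k * G k ^+ 2.
(* The Armijo condition, with the slope bounded through gradient-relatedness. *)
have dec k : f (x k.+1) + sigma * c1 * q k <= r k.
  have [tk0 _ h _] := search k.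
  have := ler_wpM2l (ltW (mulr_gt0 s0 tk0)) (slope k).
  by rewrite /q; move: h; lra.
have q0 k : 0 <= q k by rewrite mulr_ge0// ?sqr_ge0//; case/andP: (t01 k).
have fr k : f (x k) <= r k by rewrite -[k in x k]subn0; exact: ref_ge.
have frS k : f (x k.+1) <= r k.
  by apply: le_trans (dec k); rewrite lerDl mulr_ge0// mulr_ge0// ltW.
have rS k : r k.+1 <= r k by exact: ref_nonincreasing mem frS k.
(* As [m 0 = 0], the reference values start at [f x0] or below, and they never increase. *)
have L0 k : f (x k) <= f x0.
  apply: (le_trans (fr k)); elim: k => [|k IH]; last exact: le_trans (rS k) IH.
  by apply: ref_le => j; rewrite mem.1 leqn0 => /eqP->; rewrite x0E.
have [B hB] := @compact_range_bounded _ _ _ f L0c cf.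
have [BG hBG] := @compact_range_bounded _ _ _ (@enorm R n \o gradient f) L0c
  (fun z => continuous_comp (cg z) (@enorm_continuous R n _)).
have q_small : forall e, 0 < e -> exists N, forall k, (N <= k)%N -> q k < e.
  apply: (@nonmonotone_decrease _ (f \o x) r q (sigma * c1) (- B) M) => //.
  - exact: mulr_gt0.
  - move=> k; apply: le_trans (fr k).
    by have := hB _ (L0 k); rewrite ler_norml => /andP[].
  - by move=> k; exact: (ref_window _ _ _ _ _ _ _ mem).
  move=> e e0; have [rho rho0 hrho] := @compact_unif_cont _ _ f _ L0c cf e e0.
  have [theta theta0 htheta] : exists2 theta, 0 < theta &
      forall s, 0 <= s -> s < theta -> y s < rho.
    have /cvgrPdist_lt/(_ _ rho0)/nbhs_ballP[theta /= theta0 h] := ycvg.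
    exists theta => // s s_ge0 sth.
    have := h s; rewrite -ball_normE /= !sub0r !normrN !ger0_norm ?y0//; exact.
  (* This threshold forces [t k * enorm (d k) < theta], so the forcing function bounds the step by
     [rho]. *)
  exists ((theta / c2) ^+ 2) => [|k qk]; first by rewrite exprn_gt0// divr_gt0.
  apply: hrho; first exact: L0.
  apply: (le_lt_trans (norm_le_enorm _ _ _)).
  rewrite xS -{1}gamma0; apply: (le_lt_trans (yx k _ (t01 k))); apply: htheta.
    by rewrite mulr_ge0 ?enorm_ge0//; case/andP: (t01 k).
  exact: small_step (t01 k) (enorm_ge0 _ _ _) c20 theta0 (dG k) qk.
have t_lb c : 0 < c -> exists2 tau, 0 < tau & forall k, c <= G k -> tau <= t k.
  move=> c0; have e0 : 0 < c1 * c ^+ 2 by rewrite mulr_gt0// exprn_gt0.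
  (* Compact ranges: the level set for [x k], a cube for [d k] since
     [enorm (d k) <= c2 * G k <= c2 * BG], and a cube for [xi k]. *)
  have [tau tau0 htau] :=
    rejected_step_bounded_below _ _ _ _ _ _ _ _ _ fC1 adm s1 L0c
    (cube_compact R n (c2 * BG)) (cube_compact R p C) _ e0.
  case/andP: (d01) => dl0 dl1.
  exists (Num.min Delta0 (delta * tau)); first by rewrite lt_min D0 mulr_gt0.
  move=> k cG; have [tk0 tkD _ [->|[s [sgt0 sD -> rej]]]] := search k.
    by rewrite ge_min lexx.
  rewrite ge_min; apply/orP; right; rewrite ler_pM2l//.
  apply: (htau s (x k) (d k) (xi k)) => //.
  - by rewrite sgt0 (le_trans sD).
  - exact: L0.
  - apply: enorm_cube; apply: (le_trans (dG k)); rewrite ler_pM2l//.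
    by have := hBG _ (L0 k); rewrite /= ger0_norm ?enorm_ge0.
  - exact: enorm_cube.
  - apply: (le_trans (slope k)); rewrite mulNr lerN2 ler_pM2l//.
    by rewrite lerXn2r ?nnegrE ?enorm_ge0// ltW.
  (* Rejection against [r k] implies rejection against [f (x k)], as [f (x k) <= r k]. *)
  - by apply: le_lt_trans rej; rewrite lerD2r.
(* Otherwise [c <= G k] would give [tau * c ^+ 2 <= q k] for some large [k]. *)
have G_small c : 0 < c -> exists N, forall k, (N <= k)%N -> G k < c.
  move=> c0; have [tau tau0 htau] := t_lb _ c0.
  have [N hN] := q_small (tau * c ^+ 2) (mulr_gt0 tau0 (exprn_gt0 2 c0)).
  exists N => k /hN; apply: contraTT; rewrite -!leNgt => cG.
  by rewrite ler_pM ?sqr_ge0 ?htau// ?lerXn2r ?nnegrE ?enorm_ge0// ltW.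
split.
  have xL0 : (x @ \oo) [set z | f z <= f x0] by exists 0%N => // k _; exact: L0.
  by have [xbar [_ ?]] := L0c (x @ \oo) _ xL0; exists xbar.
move=> xbar clx; apply/rowP => i; rewrite [RHS]mxE.
apply/eqP/negPn/negP => gi0.
(* A nonzero coordinate of the gradient at [xbar] keeps size above [c / 2] nearby, while
   [G k < c / 2] for late iterates, some of which are near [xbar]. *)
pose c := `|gradient f xbar ord0 i|.
have c0 : 0 < c / 2 by rewrite divr_gt0// normr_gt0.
have [N hN] := G_small _ c0.
have nb : \forall z \near xbar,
    `|gradient f xbar ord0 i - gradient f z ord0 i| < c / 2.
  have : gradient f z ord0 i @[z --> xbar] --> gradient f xbar ord0 i.
    exact: (cvg_comp _ _ (cg xbar) (@coord_continuous R 1 n ord0 i _)).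
  by move/cvgrPdist_lt/(_ _ c0).
have ev : (x @ \oo) (x @` [set k | (N <= k)%N]).
  by exists N => // k /= Nk; exists k.
have [_ [[k /= Nk <-] hk]] := clx _ _ ev nb.
have := hN _ Nk; have := coord_le_enorm _ _ (g k) i.
have := ler_distD (g k ord0 i) (gradient f xbar ord0 i) 0.
by rewrite !subr0 -/c; move: hk; rewrite /= /G /g; lra.
Qed.
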